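(* Let $\mathcal{Z}\subseteq\mathbb{R}^n$ be a (nonempty) closed convex set and let $F:\mathcal{Z}\rightarrow\mathbb{R}^n$ be Lipschitz continuous with constant $L$ and strongly monotone with constant $\mu$, where $L\ge\mu>0$. Let $z^*$ be the unique solution of the variational inequality: $z^*\in\mathcal{Z}$, $F(z^* )^\top(z-z^* )\ge 0$ for all $z\in\mathcal{Z}$. Let real parameters $\alpha,\beta,\gamma,\eta,\tau$ satisfy \[ \left\{ \begin{array}{l} 0\leq\tau L < \alpha\mu-4\gamma-2|\gamma-\beta|-2\tau L<1,\\ 2\gamma+2|\gamma-\beta|+2\tau L< (\alpha\mu-4\gamma-2|\gamma-\beta|-2\tau L)-\tau L,\\ \alpha L+|\gamma-\beta|-1\leq 0,\\ \alpha L+2\alpha\mu+\tau L+2\gamma-1 \leq 0,\\ \eta=\alpha, \\ \alpha,\beta,\gamma,\eta,\tau \geq 0. \end{array} \right. \] Define \[ a= \frac{\alpha\mu-4\gamma-2|\gamma-\beta|-3\tau L}{1-\tau L},\qquad b = \frac{2\gamma+2|\gamma-\beta|+2\tau L}{1-\tau L}, \] and let $\theta$ satisfy \[ b<\frac{\sqrt{(1-a)^2+4b}-(1-a)}{2}\leq \theta <a . \] Then the sequence $\{z^k\}$ generated from initial points $z^{-1},z^0\in\mathcal{Z}$ by \[ \left\{ \begin{array}{ccl} z^{k+0.5} &=& P_{\mathcal{Z}}\left(z^k+\beta(z^k-z^{k-1})-\eta F(z^k)\right), \\ z^{k+1} &=& P_{\mathcal{Z}}\left(z^k-\alpha F(z^{k+0.5})+\gamma(z^k-z^{k-1})-\tau\left(F(z^{k})-F(z^{k-1})\right)\right),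 \end{array} \right.\qquad k=0,1,2,\dots \] satisfies, for every $k=0,1,2,\dots$, \[ \|z^{k+1}-z^*\|^2+\theta\|z^k-z^*\|^2\leq (1-(a-\theta))\|z^k-z^*\|^2+\theta(1-(a-\theta))\|z^{k-1}-z^*\|^2 . \]
   Context: $\|\cdot\|$ is the Euclidean norm on $\mathbb{R}^n$ and $P_{\mathcal{Z}}(z)=\arg\min_{z'\in\mathcal{Z}}\|z-z'\|^2$ is the Euclidean projection onto $\mathcal{Z}$. $F$ is Lipschitz continuous with constant $L$ if $\|F(z)-F(z')\|\le L\|z-z'\|$ for all $z,z'\in\mathcal{Z}$; $F$ is strongly monotone with constant $\mu$ if $(F(z)-F(z'))^\top(z-z')\ge\mu\|z-z'\|^2$ for all $z,z'\in\mathcal{Z}$. Under these assumptions the variational inequality has a unique solution $z^*$. *)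

(* Defs.v *)
From mathcomp Require Import all_boot all_order all_algebra.
From mathcomp Require Import all_classical all_reals all_analysis.
Import Order.TTheory GRing.Theory Num.Theory.
Import numFieldNormedType.Exports.

Set Implicit Arguments.
Unset Strict Implicit.
Unset Printing Implicit Defensive.

Local Open Scope classical_set_scope.
Local Open Scope ring_scope.

Definition dotv (R : realType) (n : nat) (u v : 'rV[R]_n) : R :=
  \sum_(i < n) u ord0 i * v ord0 i.

(* The library norm `|x| on 'rV[R]_n is the sup norm. *)
Definition enorm (R : realType) (n : nat) (u : 'rV[R]_n) : R :=
  Num.sqrt (dotv u u).

Definition argmin_dist (R : realType) (n : nat) (Z : set 'rV[R]_n)
    (x : 'rV[R]_n) : set 'rV[R]_n :=
  [set p | Z p /\
     forall q, Z q -> enorm (x - p) ^+ 2 <= enorm (x - q) ^+ 2].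

(* [argmin_dist Z x] is a singleton when Z is nonempty, closed and convex;
   the default value 0 of [xget] is returned only if there is no minimizer. *)
Definition eproj (R : realType) (n : nat) (Z : set 'rV[R]_n)
    (x : 'rV[R]_n) : 'rV[R]_n :=
  xget 0 (argmin_dist Z x).

(* A map F : Z -> R^n is represented by a total function of which only the
   values on Z are constrained. *)
Definition lipschitz_const_on (R : realType) (n : nat) (Z : set 'rV[R]_n)
    (F : 'rV[R]_n -> 'rV[R]_n) (L : R) : Prop :=
  forall x y, Z x -> Z y -> enorm (F x - F y) <= L * enorm (x - y).

Definition strongly_monotone_on (R : realType) (n : nat) (Z : set 'rV[R]_n)
    (F : 'rV[R]_n -> 'rV[R]_n) (mu : R) : Prop :=
  forall x y, Z x -> Z y -> mu * enorm (x - y) ^+ 2 <= dotv (F x - F y) (x - y).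

Definition VI_solution (R : realType) (n : nat) (Z : set 'rV[R]_n)
    (F : 'rV[R]_n -> 'rV[R]_n) (zs : 'rV[R]_n) : Prop :=
  Z zs /\ forall x, Z x -> 0 <= dotv (F zs) (x - zs).

(* The main iterates are indexed by int, so that z (-1) is the initial point
   z^{-1}; the values z j with j < -1 play no role.  [zh k] is z^{k+0.5}. *)
Definition generated_by_scheme (R : realType) (n : nat) (Z : set 'rV[R]_n)
    (F : 'rV[R]_n -> 'rV[R]_n) (alpha beta gamma eta tau : R)
    (z : int -> 'rV[R]_n) (zh : nat -> 'rV[R]_n) : Prop :=
  [/\ Z (z (-1)), Z (z 0) &
    forall k : nat,
      zh k = eproj Z (z k%:Z + beta *: (z k%:Z - z (k%:Z - 1))
                      - eta *: F (z k%:Z)) /\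
      z (k%:Z + 1) = eproj Z (z k%:Z - alpha *: F (zh k)
                      + gamma *: (z k%:Z - z (k%:Z - 1))
                      - tau *: (F (z k%:Z) - F (z (k%:Z - 1))))].

(* Main.v *)
(* The obtuse-angle inequality of the two projections, tested at z^* for z^{k+1}
   and at z^{k+1} for z^{k+0.5}, is combined with strong monotonicity at
   z^{k+0.5}.  All remaining inner products are split by Young's inequality; the
   conditions on the parameters are exactly what makes the coefficients of
   |z^{k+1} - z^{k+0.5}|^2 and |z^k - z^{k+0.5}|^2 nonpositive.  This leaves
   |z^{k+1} - z^*|^2 <= (1 - a) |z^k - z^*|^2 + b |z^{k-1} - z^*|^2,
   and b <= theta (1 - a + theta) because theta is at least the positive root of
   t^2 + (1 - a) t - b. *)

Require Import Defs.
From mathcomp Require Import all_boot all_order all_algebra.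
From mathcomp Require Import all_classical all_reals all_analysis.
From mathcomp Require Import ring lra.
Import Order.TTheory GRing.Theory Num.Theory.
Import numFieldNormedType.Exports.

Local Open Scope classical_set_scope.
Local Open Scope ring_scope.

Section InnerProduct.
Context {R : realType} {n : nat}.
Implicit Types (u v w : 'rV[R]_n) (c d L : R).

Lemma dotvC u v : dotv u v = dotv v u.
Proof. by apply: eq_bigr => i _; rewrite mulrC. Qed.

Lemma dotvDl u v w : dotv (u + v) w = dotv u w + dotv v w.
Proof. by rewrite -big_split; apply: eq_bigr => i _; rewrite mxE mulrDl. Qed.

Lemma dotvZl c u w : dotv (c *: u) w = c * dotv u w.
Proof. by rewrite /dotv mulr_sumr; apply: eq_bigr => i _; rewrite mxE mulrA. Qed.

Lemma dotvNl u w : dotv (- u) w = - dotv u w.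
Proof. by rewrite -scaleN1r dotvZl mulN1r. Qed.

Lemma dotvDr u v w : dotv w (u + v) = dotv w u + dotv w v.
Proof. by rewrite dotvC dotvDl !(dotvC w). Qed.

Lemma dotvZr c u w : dotv w (c *: u) = c * dotv w u.
Proof. by rewrite dotvC dotvZl (dotvC w). Qed.

Lemma dotvNr u w : dotv w (- u) = - dotv w u.
Proof. by rewrite dotvC dotvNl (dotvC w). Qed.

Definition dotvE := (dotvDl, dotvDr, dotvNl, dotvNr, dotvZl, dotvZr).

Lemma dotv_ge0 u : 0 <= dotv u u.
Proof. by apply: sumr_ge0 => i _; rewrite -expr2 sqr_ge0. Qed.

Lemma enorm_sq u : enorm u ^+ 2 = dotv u u.
Proof. by rewrite sqr_sqrtr // dotv_ge0. Qed.

(** Links the sup norm, in which boundedness is measured, to the Euclidean norm. *)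
Lemma sqr_coord_le_dotv u i : u ord0 i ^+ 2 <= dotv u u.
Proof.
rewrite /dotv (bigD1 i) //= -expr2 lerDl.
by apply: sumr_ge0 => j _; rewrite -expr2 sqr_ge0.
Qed.

Lemma dotv_subZ c u v : dotv (u - c *: v) (u - c *: v) =
  dotv u u - 2 * c * dotv u v + c ^+ 2 * dotv v v.
Proof. by rewrite !dotvE (dotvC v u); ring. Qed.

Lemma dotv_young c u v :
  2 * c * dotv u v <= `|c| * (dotv u u + dotv v v).
Proof.
have := dotv_ge0 (u - v); have := dotv_ge0 (u + v).
rewrite !dotvE (dotvC v u).
by case: (ger0P c); nra.
Qed.

(** Expanding [|u - L w|^2 >= 0] with this weight makes [L] enter linearly, not squared, after
    division by [L]. *)
Lemma dotv_young_enorm L u v w : 0 < L -> enorm u <= L * enorm v ->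
  2 * dotv u w <= L * (dotv v v + dotv w w).
Proof.
move=> L0 uv.
have {uv} : dotv u u <= L ^+ 2 * dotv v v.
  by rewrite -!enorm_sq -exprMn lerXn2r // nnegrE ?mulr_ge0 ?sqrtr_ge0 // ltW.
have := dotv_ge0 (u - L *: w); rewrite dotv_subZ => uw uv.
by rewrite -(ler_pM2l L0); lra.
Qed.

End InnerProduct.

Section Projection.
Context {R : realType} {n : nat}.
Implicit Types (Z : set 'rV[R]_n) (x p q : 'rV[R]_n).

Lemma dist_sq_continuous x : continuous (fun q => dotv (x - q) (x - q)).
Proof.
rewrite /dotv; apply: continuous_big => [|i _ q]; first exact: add_continuous.
have -> : (fun q => (x - q) ord0 i * (x - q) ord0 i) =
          (fun q => x ord0 i - q ord0 i) \* (fun q => x ord0 i - q ord0 i).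
  by apply/funext => v; rewrite !mxE.
have h : {for q, continuous (fun v : 'rV[R]_n => x ord0 i - v ord0 i)}.
  by apply: continuousB; [exact: cst_continuous | exact: coord_continuous].
exact: continuousM.
Qed.

(** Points farther from [x] than some fixed [z0] of [Z] cannot compete, so it suffices to minimize
    over a compact sublevel set. *)
Lemma argmin_dist_exists Z x : Z !=set0 -> closed Z -> argmin_dist Z x !=set0.
Proof.
move=> [z0 Zz0] clZ.
pose f q := dotv (x - q) (x - q).
have fc : continuous f := @dist_sq_continuous x.
pose A := Z `&` f @^-1` [set r | r <= f z0].
have A0 : A !=set0 by exists z0; split => //=.
have cA : compact A.
  apply: bounded_closed_compact.
    (* Each coordinate [t] of [x - q] satisfies [|t| <= t^2 + 1 <= f z0 + 1]. *)
    exists (`|x| + (f z0 + 1)); split; first exact: num_real.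
    move=> M HM q [_ /= qf]; apply: le_trans (ltW HM).
    rewrite -[q](subKr x) (le_trans (ler_normB _ _)) // lerD2l.
    rewrite [leLHS]mx_normrE; apply: bigmax_le => [|[i j] _ /=].
      by rewrite addr_ge0 // dotv_ge0.
    rewrite (ord1 i); have := sqr_coord_le_dotv (x - q) j.
    rewrite -/(f q) -real_normK ?num_real // => h.
    have := sqr_ge0 (`|(x - q) ord0 j| - 1).
    by have := normr_ge0 ((x - q) ord0 j); nra.
  apply: closedI => //; apply: closed_comp; last exact: closed_le.
  by move=> q _; exact: fc.
have [c /set_mem[Zc fcz0] cmin] :=
  EVT_min_rV A0 cA (continuous_subspaceT fc).
exists c; split => // q Zq; rewrite !enorm_sq.
have [qz0|/ltW z0q] := lerP (f q) (f z0).
  by apply: cmin; rewrite inE.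
exact: le_trans z0q.
Qed.

Lemma argmin_dist_obtuse Z x p q : convex_set Z -> argmin_dist Z x p -> Z q ->
  dotv (x - p) (q - p) <= 0.
Proof.
move=> cZ [Zp pmin] Zq; rewrite leNgt; apply/negP => c0.
set c := dotv _ _ in c0; pose D := dotv (q - p) (q - p).
have D0 : 0 <= D := dotv_ge0 _.
have cD : 0 < c + D by rewrite ltr_wpDr.
(* The optimal step [c / D] may exceed 1 or have [D = 0]; this one lies in [0, 1] and still has
   [t * D <= c < 2 * c]. *)
pose t := c / (c + D).
have t0 : 0 <= t by rewrite divr_ge0 // ltW.
have t1 : t <= 1 by rewrite ler_pdivrMr // mul1r lerDl.
(* moving from p towards q by t would bring us strictly closer to x *)
have Zt : Z (t *: q + (1 - t) *: p).
  have := cZ q p (Itv01 t0 t1); rewrite !inE; exact.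
have := pmin _ Zt; rewrite !enorm_sq.
have -> : x - (t *: q + (1 - t) *: p) = (x - p) - t *: (q - p).
  by apply/rowP => i; rewrite !mxE; ring.
rewrite dotv_subZ -/c -/D => h.
have tE : t * (c + D) = c by rewrite divfK // gt_eqF.
have t_gt0 : 0 < t by rewrite divr_gt0.
have : t * (2 * c) <= t * (t * D) by lra.
rewrite ler_pM2l //; nra.
Qed.

Lemma eproj_spec Z x : Z !=set0 -> closed Z -> convex_set Z ->
  Z (eproj Z x) /\ forall q, Z q -> dotv (x - eproj Z x) (q - eproj Z x) <= 0.
Proof.
move=> Z0 clZ cZ.
have h : argmin_dist Z x (eproj Z x) := xgetPex 0 (argmin_dist_exists Z x Z0 clZ).
by split=> [|q]; [case: h | exact: argmin_dist_obtuse].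
Qed.

End Projection.

(** Here [s] is the solution, [y], [x], [p] are consecutive iterates and [w] is the half step. Both
    projections use the same step [alpha], so their sum contains [F] only through [Fw.(w - s)],
    [(Fx - Fw).(p - w)] and [(Fx - Fy).(s - p)]. *)
Lemma extragradient_step {R : realType} {n : nat} (s x y w p Fw Fx Fy : 'rV[R]_n)
    (L mu alpha beta gamma tau : R) :
  let d := `|gamma - beta| in
  0 < L -> 0 <= mu -> 0 <= alpha -> 0 <= gamma -> 0 <= tau ->
  alpha * L + d - 1 <= 0 ->
  alpha * L + 2 * alpha * mu + tau * L + 2 * gamma - 1 <= 0 ->
  dotv (x - alpha *: Fw + gamma *: (x - y) - tau *: (Fx - Fy) - p) (s - p) <= 0 ->
  dotv (x + beta *: (x - y) - alpha *: Fx - w) (p - w) <= 0 ->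
  mu * dotv (w - s) (w - s) <= dotv Fw (w - s) ->
  enorm (Fx - Fw) <= L * enorm (x - w) ->
  enorm (Fx - Fy) <= L * enorm (x - y) ->
  (1 - tau * L) * dotv (p - s) (p - s) <=
    (1 - (alpha * mu - 4 * gamma - 2 * d - 2 * tau * L)) * dotv (x - s) (x - s)
    + (2 * gamma + 2 * d + 2 * tau * L) * dotv (y - s) (y - s).
Proof.
move=> d L0 mu0 al0 ga0 tau0 c3 c4 pproj wproj Fmon Fxw Fxy.
have d0 : 0 <= d by exact: normr_ge0.
have {}Fmon := ler_wpM2l al0 Fmon.
have {}Fxw := ler_wpM2l al0 (dotv_young_enorm L _ _ (p - w) L0 Fxw).
have {}Fxy := ler_wpM2l tau0 (dotv_young_enorm L _ _ (s - p) L0 Fxy).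
(* The inertial terms sum to [-(gamma - beta) (x - y).(p - w) - gamma (x - y).(w - s)]. *)
have yxp := dotv_young (gamma - beta) (x - y) (p - w).
have yxw := dotv_young gamma (x - y) (w - s).
rewrite (ger0_norm ga0) in yxw.
have pw : 0 <= (1 - alpha * L - d) * dotv (p - w) (p - w).
  by rewrite mulr_ge0 ?dotv_ge0 //; lra.
have xw : 0 <= (1 - alpha * L - 2 * alpha * mu - 2 * gamma) * dotv (x - w) (x - w).
  rewrite mulr_ge0 ?dotv_ge0 //.
  have : 0 <= tau * L by rewrite mulr_ge0 // ltW.
  lra.
(* the parallelogram inequality |u|^2 <= 2 |v|^2 + 2 |u - v|^2, used three times *)
have xs : 0 <= alpha * mu * dotv ((w - s) + (w - x)) ((w - s) + (w - x)).
  by rewrite !mulr_ge0 ?dotv_ge0.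
have ws : 0 <= gamma * dotv ((x - s) - (w - x)) ((x - s) - (w - x)).
  by rewrite mulr_ge0 ?dotv_ge0.
have xy : 0 <= (d + gamma + tau * L) * dotv ((x - s) + (y - s)) ((x - s) + (y - s)).
  by rewrite mulr_ge0 ?dotv_ge0 // !addr_ge0 // mulr_ge0 // ltW.
move: pproj wproj Fmon Fxw Fxy yxp yxw pw xw xs ws xy; rewrite -/d.
rewrite !dotvE.
(* Each symmetric product gets one orientation; the claim is then a linear combination of the
   hypotheses, with the projection and monotonicity ones doubled. *)
rewrite ?(dotvC y x, dotvC w x, dotvC p x, dotvC s x, dotvC w y, dotvC p y,
          dotvC s y, dotvC p w, dotvC s w, dotvC s p).
clear; lra.
Qed.


Theorem theorem3p5 (R : realType) (n : nat) (Z : set 'rV[R]_n)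
  (F : 'rV[R]_n -> 'rV[R]_n) (L mu : R)
  (Z_nonempty : Z !=set0) (Z_closed : closed Z) (Z_convex : convex_set Z)
  (mu_gt0 : 0 < mu) (mu_le_L : mu <= L)
  (F_lipschitz : lipschitz_const_on Z F L)
  (F_monotone : strongly_monotone_on Z F mu)
  (zs : 'rV[R]_n) (zs_sol : VI_solution Z F zs)
  (alpha beta gamma eta tau : R)
  (cond1a : 0 <= tau * L)
  (cond1b : tau * L <
     alpha * mu - 4 * gamma - 2 * `|gamma - beta| - 2 * tau * L)
  (cond1c : alpha * mu - 4 * gamma - 2 * `|gamma - beta| - 2 * tau * L < 1)
  (cond2 : 2 * gamma + 2 * `|gamma - beta| + 2 * tau * L <
     (alpha * mu - 4 * gamma - 2 * `|gamma - beta| - 2 * tau * L) - tau * L)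
  (cond3 : alpha * L + `|gamma - beta| - 1 <= 0)
  (cond4 : alpha * L + 2 * alpha * mu + tau * L + 2 * gamma - 1 <= 0)
  (cond5 : eta = alpha)
  (alpha_ge0 : 0 <= alpha) (beta_ge0 : 0 <= beta) (gamma_ge0 : 0 <= gamma)
  (eta_ge0 : 0 <= eta) (tau_ge0 : 0 <= tau)
  (a b theta : R)
  (def_a : a = (alpha * mu - 4 * gamma - 2 * `|gamma - beta| - 3 * tau * L)
               / (1 - tau * L))
  (def_b : b = (2 * gamma + 2 * `|gamma - beta| + 2 * tau * L)
               / (1 - tau * L))
  (b_lt_root : b < (Num.sqrt ((1 - a) ^+ 2 + 4 * b) - (1 - a)) / 2)
  (root_le_theta : (Num.sqrt ((1 - a) ^+ 2 + 4 * b) - (1 - a)) / 2 <= theta)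
  (theta_lt_a : theta < a)
  (z : int -> 'rV[R]_n) (zh : nat -> 'rV[R]_n)
  (z_gen : generated_by_scheme Z F alpha beta gamma eta tau z zh)
  (k : nat) :
  enorm (z (k%:Z + 1) - zs) ^+ 2 + theta * enorm (z k%:Z - zs) ^+ 2
  <= (1 - (a - theta)) * enorm (z k%:Z - zs) ^+ 2
     + theta * (1 - (a - theta)) * enorm (z (k%:Z - 1) - zs) ^+ 2.
Proof.
have L_gt0 : 0 < L := lt_le_trans mu_gt0 mu_le_L.
have tauL1 : 0 < 1 - tau * L by lra.
have proj x := eproj_spec Z x Z_nonempty Z_closed Z_convex.
case: z_gen => Zm1 Z0 zE.
have Zz (j : nat) : Z (z j%:Z).
  case: j => // j; have [_] := zE j.
  by rewrite (addrC j%:Z) -intS => ->; exact: (proj _).1.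
(* For [k = 0] this is the initial point [z (-1)]. *)
have Zz1 : Z (z (k%:Z - 1)).
  case: (k) => [|j]; first by rewrite sub0r.
  by rewrite intS addrAC subrr add0r.
have [zhE zkE] := zE k.
have Zh : Z (zh k) by rewrite zhE; exact: (proj _).1.
have Zk1 : Z (z (k%:Z + 1)) by rewrite zkE; exact: (proj _).1.
have [Zs VIs] := zs_sol.
have pproj := (proj (z k%:Z - alpha *: F (zh k) + gamma *: (z k%:Z - z (k%:Z - 1))
   - tau *: (F (z k%:Z) - F (z (k%:Z - 1))))).2 _ Zs.
have wproj := (proj (z k%:Z + beta *: (z k%:Z - z (k%:Z - 1)) - eta *: F (z k%:Z))).2
  _ Zk1.
rewrite -zkE in pproj; rewrite -zhE cond5 in wproj.
(* The variational inequality tested at [zh k] lets [F zs] be dropped from strong monotonicity. *)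
have Fmon : mu * dotv (zh k - zs) (zh k - zs) <= dotv (F (zh k)) (zh k - zs).
  have := F_monotone _ _ Zh Zs; rewrite enorm_sq [X in _ <= X]dotvDl dotvNl.
  by have := VIs _ Zh; lra.
have := extragradient_step _ _ _ _ _ _ _ _ _ _ _ _ _ _ L_gt0 (ltW mu_gt0)
  alpha_ge0 gamma_ge0 tau_ge0 cond3 cond4 pproj wproj Fmon
  (F_lipschitz _ _ (Zz k) Zh) (F_lipschitz _ _ (Zz k) Zz1).
rewrite -!enorm_sq => step.
move: (enorm (z (k%:Z - 1) - zs) ^+ 2) (sqr_ge0 (enorm (z (k%:Z - 1) - zs))) step.
move: (enorm (z (k%:Z + 1) - zs) ^+ 2) (enorm (z k%:Z - zs) ^+ 2) => P X Y Y_ge0 step.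
have aE : (1 - tau * L) * a = alpha * mu - 4 * gamma - 2 * `|gamma - beta| - 3 * tau * L.
  by rewrite def_a mulrC divfK // gt_eqF.
have bE : (1 - tau * L) * b = 2 * gamma + 2 * `|gamma - beta| + 2 * tau * L.
  by rewrite def_b mulrC divfK // gt_eqF.
(* The left factor [1 - tau * L] accounts for [3 * tau * L] in [a] against [2 * tau * L] in the
   step: [(1 - tau L)(1 - a)] is the coefficient of [X] there. *)
have {}step : P <= (1 - a) * X + b * Y.
  rewrite -(ler_pM2l tauL1) mulrDr !mulrA bE mulrBr aE.
  by apply: le_trans step _; rewrite -mulrA; lra.
have b_ge0 : 0 <= b.
  rewrite def_b divr_ge0 ?(ltW tauL1) //.
  by have := normr_ge0 (gamma - beta); lra.
have b_le : b <= theta * (1 - (a - theta)).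
  set D := (1 - a) ^+ 2 + 4 * b in root_le_theta.
  have D0 : 0 <= D by rewrite addr_ge0 ?sqr_ge0 // mulr_ge0.
  have : Num.sqrt D <= 2 * theta + (1 - a) by lra.
  (* Squaring cancels [(1 - a)^2] and leaves [4 b <= 4 theta (1 - a + theta)]. *)
  move=> h; have := ler_pM (sqrtr_ge0 D) (sqrtr_ge0 D) h h.
  by rewrite -expr2 sqr_sqrtr // /D; lra.
by have := ler_wpM2r Y_ge0 b_le; lra.
Qed.
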